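(* Let $S$ be a complete semiring, $(\mathbf{C},\otimes,I)$ a small strict monoidal category, $\mathcal{F}$ a system of fields and $\mathbb{T}$ a system of $\mathbf{C}$-valued action exponentials. The state sum $Z_{W\sqcup W'}\in Z(\partial W\sqcup\partial W')$ of an ordered disjoint union of bordisms $W$ and $W'$ is the tensor product $$Z_{W\sqcup W'}=Z_W\,\widehat{\otimes}_m\,Z_{W'}\in Z(\partial W)\,\widehat{\otimes}\,Z(\partial W')\cong Z(\partial W\sqcup\partial W'),$$ i.e. $Z_{W\sqcup W'}(f)=Z_W(f|_{\partial W})\times Z_{W'}(f|_{\partial W'})$ for all $f\in\mathcal{F}(\partial W\sqcup\partial W')$.
   Context: A semiring $(S,+,\cdot,0,1)$ consists of a commutative monoid $(S,+,0)$ and a (not necessarily commutative) monoid $(S,\cdot,1)$ such that $\cdot$ distributes over $+$ from both sides and $0$ is absorbing. A complete monoid is a commutative monoid $(M,+,0)$ with a summation law assigning to every family $(m_i)_{i\in I}$, $I$ an arbitrary set, an element $\sum_{i\in I}m_i$ such that $\sum_{i\in\varnothing}m_i=0$, $\sum_{i\in\{1\}}m_i=m_1$, $\sum_{i\in\{1,2\}}m_i=m_1+m_2$, and $\sum_{j\in J}\big(\sum_{i\in I_j}m_i\big)=\sum_{i\in I}m_i$ for every partition $I=\bigcup_{j\in J}I_j$. A semiring is complete if $(S,+,0,\sum)$ is a complete monoid and $\sum_i ss_i=s\sum_i s_i$, $\sum_i s_is=(\sum_i s_i)s$. $Q=Q_S(\mathbf{C})$ is the complete monoid of functions $\operatorname{Mor}(\mathbf{C})\to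 S$ with pointwise addition and summation. The monoidal semiring is $Q^m=(Q,+,\times,0,1^\times)$ with $(a\times b)(\gamma)=\sum_{\alpha\otimes\beta=\gamma}b(\beta)a(\alpha)$ (sum over all pairs $(\alpha,\beta)$ of morphisms with $\alpha\otimes\beta=\gamma$) and $1^\times$ the characteristic function of $\operatorname{id}_I$; it is a complete semiring. Fix an integer $n\ge 0$. Manifolds are topological and need not be orientable; $\varnothing$ is a manifold of every dimension; $\sqcup$ is the ordered disjoint union. A bordism from $M$ to $N$ is a triple $(W,M,N)$ (often abbreviated $W$) with $W$ a compact $(n+1)$-dimensional topological manifold, $\partial W=M\sqcup N$, where the closed $n$-manifolds $M,N$ are the incoming and outgoing boundary. $(W,M,N)\sqcup(W',M',N')=(W\sqcup W',M\sqcup M',N\sqcup N')$; its boundary is canonically identified with $\partial W\sqcup\partial W'$. If $W'$ is a bordism from $M$ to $N$ and $W''$ a bordism from $N$ to $P$, gluing along $N$ yields the bordism $W'\cup_N W''$ from $M$ to $P$. A homeomorphism of bordisms is a homeomorphism preserving incoming and outgoing boundaries. $(W_0,M_0,N_0)$ is a subbordism of $(W,M,N)$ if $W_0\subset W$ is a codimension $0$ submanifold, every connected component $C$ of $M_0$ satisfies $C\cap\partial W=\varnothing$ or $C\subset M$, and every connected component $C$ of $N_0$ satisfies $C\cap\partial W=\varnothing$ or $C\subset N$. A system $\mathcal{F}$ of fields assigns to each bordism $W$ a set $\mathcal{F}(W)$ and to each closed $n$-manifold $M$ a set $\mathcal{F}(M)$, with $\mathcal{F}(\varnothing)$ a one-element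 set, such that: (FRES) There are restriction maps $\mathcal{F}(W)\to\mathcal{F}(W_0)$ for subbordisms $W_0\subset W$, $\mathcal{F}(M)\to\mathcal{F}(M_0)$ for codimension $0$ submanifolds $M_0\subset M$, and $\mathcal{F}(W)\to\mathcal{F}(M)$ for closed codimension $1$ submanifolds $M\subset W$; they are written $f\mapsto f|_{(-)}$ and commute with each other in the obvious way (restricting in stages equals restricting directly). (FHOMEO) A homeomorphism of bordisms $\phi:W\to W'$ induces a bijection $\phi^*:\mathcal{F}(W')\to\mathcal{F}(W)$ with $(\operatorname{id}_W)^*=\operatorname{id}$, $(\psi\circ\phi)^*=\phi^*\circ\psi^*$; similarly for homeomorphisms of closed $n$-manifolds; these maps commute with the restriction maps. (FDISJ) The products of restrictions $\mathcal{F}(W\sqcup W')\to\mathcal{F}(W)\times\mathcal{F}(W')$ and $\mathcal{F}(M\sqcup N)\to\mathcal{F}(M)\times\mathcal{F}(N)$ are bijections. (FGLUE) For $W=W'\cup_N W''$, the map $\mathcal{F}(W)\to\mathcal{F}(W')\times_{\mathcal{F}(N)}\mathcal{F}(W'')$ given by the restrictions to $W'$ and $W''$ is a bijection onto the pullback. A system $\mathbb{T}$ of $\mathbf{C}$-valued action exponentials consists of functions $\mathbb{T}_W:\mathcal{F}(W)\to\operatorname{Mor}(\mathbf{C})$ for all bordisms $W$ with $\mathbb{T}_\varnothing(p)=\operatorname{id}_I$ ($p$ the unique element of $\mathcal{F}(\varnothing)$) such that: (TDISJ) $\mathbb{T}_{W\sqcup W'}(f)=\mathbb{T}_W(f|_W)\otimes\mathbb{T}_{W'}(f|_{W'})$;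 (TGLUE) for $W=W'\cup_NW''$, $\mathbb{T}_W(f)=\mathbb{T}_{W''}(f|_{W''})\circ\mathbb{T}_{W'}(f|_{W'})$; (THOMEO) for a homeomorphism of bordisms $\phi:W\to W'$ and $f\in\mathcal{F}(W')$, $\mathbb{T}_W(\phi^*f)=\mathbb{T}_{W'}(f)$. For a closed $n$-manifold $M$, the state module $Z(M)$ is the set of functions $z:\mathcal{F}(M)\to Q$ with $z(\phi^*f)=z(f)$ for all $f$ and all homeomorphisms $\phi:M\to M$ isotopic to the identity; equivalently functions on the quotient $\overline{\mathcal{F}}(M)$ of $\mathcal{F}(M)$ by $f\sim\phi^*f$. $Z(M)\,\widehat{\otimes}\,Z(N)$ is the set of functions $\overline{\mathcal{F}}(M)\times\overline{\mathcal{F}}(N)\to Q$, identified with $Z(M\sqcup N)$ via $f\mapsto(f|_M,f|_N)$. For $z\in Z(M)$, $z'\in Z(N)$, $(z\,\widehat{\otimes}_m\,z')(f,g)=z(f)\times z'(g)$. For a bordism $W$ and $F\in\mathcal{F}(W)$, $T_W(F)\in Q$ is the characteristic function of the morphism $\mathbb{T}_W(F)$ (value $1\in S$ at $\mathbb{T}_W(F)$, $0$ elsewhere). For $f\in\mathcal{F}(\partial W)$ let $\mathcal{F}(W,f)=\{F\in\mathcal{F}(W)\mid F|_{\partial W}=f\}$. The state sum $Z_W\in Z(\partial W)$ is $Z_W(f)=\sum_{F\in\mathcal{F}(W,f)}T_W(F)\in Q$, using the summation law of $Q$. *)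

(* Defs.v *)
From HB Require Import structures.
From mathcomp Require Import all_boot all_order all_algebra.
From mathcomp Require Import all_classical all_reals topology normedtype.

Set Implicit Arguments.
Unset Strict Implicit.
Unset Printing Implicit Defensive.

Import Order.TTheory GRing.Theory Num.Theory.
Import numFieldNormedType.Exports.

Local Open Scope classical_set_scope.
Local Open Scope ring_scope.

Section sum_topology.
Context {X Y : topologicalType}.

Definition sum_open : set_system (X + Y)%type :=
  [set U | open (inl @^-1` U) /\ open (inr @^-1` U)].

Let sum_openT : sum_open setT.
Proof. by split; rewrite preimage_setT; exact: openT. Qed.

Let sum_openI : setI_closed sum_open.
Proof. by move=> U V [? ?] [? ?]; split; rewrite preimage_setI; exact: openI. Qed.

Let sum_open_bigU (I : Type) (f : I -> set (X + Y)%type) :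
  (forall i, sum_open (f i)) -> sum_open (\bigcup_i f i).
Proof.
by move=> fo; split; rewrite preimage_bigcup; apply: bigcup_open => i _;
  have [] := fo i.
Qed.

HB.instance Definition _ :=
  isOpenTopological.Build (X + Y)%type sum_openT sum_openI sum_open_bigU.

End sum_topology.

Definition is_homeo (X Y : topologicalType) (f : X -> Y) : Prop :=
  continuous f /\ exists g : Y -> X, [/\ continuous g, cancel f g & cancel g f].

Definition homeomorphic (X Y : topologicalType) : Prop :=
  exists f : X -> Y, is_homeo f.

(* The point x of T lies in the domain of a chart with values in E. *)
Definition locally_like (E T : topologicalType) (x : T) : Prop :=
  exists U : set T, [/\ open U, U x &
    exists V : set E, open V /\ homeomorphic U V].

Definition half_space (R : realType) (n : nat) : set 'rV[R]_n.+1 :=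
  [set v | 0 <= v ord0 ord0].
Arguments half_space : clear implicits.

(* Second countability is not required: it is automatic for compact spaces
   that are locally Euclidean (or locally half-Euclidean). *)
Record closed_manifold (R : realType) (n : nat) (T : topologicalType) : Prop := {
  closed_manifold_compact : compact [set: T];
  closed_manifold_hausdorff : hausdorff_space T;
  closed_manifold_chart : forall x : T, locally_like 'rV[R]_n x }.

(* The dimension is n.+1. *)
Record compact_manifold (R : realType) (n : nat) (T : topologicalType) : Prop := {
  compact_manifold_compact : compact [set: T];
  compact_manifold_hausdorff : hausdorff_space T;
  compact_manifold_chart : forall x : T, locally_like (half_space R n) x }.

(* The boundary of a manifold of dimension n.+1. *)
Definition manifold_boundary (R : realType) (n : nat) (T : topologicalType) :
  set T := [set x | ~ locally_like 'rV[R]_n.+1 x].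
Arguments manifold_boundary : clear implicits.

Definition open_embedding (X Y : topologicalType) (j : X -> Y) : Prop :=
  [/\ continuous j, injective j & forall U, open U -> open (j @` U)].

Section set_type_topology.
Context {X : topologicalType}.
Implicit Types A B : set X.

Definition elt (A : set X) (x : X) (Ax : A x) : A := exist _ x (mem_set Ax).

Lemma set_val_inj A : injective (set_val : A -> X).
Proof. exact: val_inj. Qed.

Lemma set_val_continuous A : continuous (set_val : A -> X).
Proof. exact: initial_continuous. Qed.

Lemma open_set_typeP A (U : set A) :
  open U <-> exists2 O : set X, open O & U = set_val @^-1` O.
Proof. by split=> [[O oO <-]|[O oO ->]]; exists O. Qed.

Lemma continuous_to_set_type (T : topologicalType) A (f : T -> A) :
  continuous (set_val \o f) -> continuous f.
Proof.
move=> /continuousP cf; apply/continuousP => _ /open_set_typeP[O oO ->].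
exact: cf.
Qed.

Lemma set_val_open_embedding A : open A -> open_embedding (set_val : A -> X).
Proof.
move=> oA; split; [exact: set_val_continuous|exact: set_val_inj|].
move=> _ /open_set_typeP[O oO ->].
have -> : set_val @` (set_val @^-1` O : set A) = O `&` A; last exact: openI.
apply/seteqP; split=> [_ [x Ox <-]|x [Ox Ax]]; first by split=> //; exact: set_valP.
by exists (elt Ax).
Qed.

Definition incl A B (AB : A `<=` B) (x : A) : B := elt (AB _ (set_valP x)).

Lemma incl_continuous A B (AB : A `<=` B) : continuous (incl AB).
Proof. by apply: continuous_to_set_type; exact: set_val_continuous. Qed.

Lemma incl_inj A B (AB : A `<=` B) : injective (incl AB).
Proof. by move=> x y xy; apply: set_val_inj; exact: (congr1 set_val xy). Qed.

End set_type_topology.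

Section open_embedding.

Lemma open_embedding_comp (X Y Z : topologicalType) (f : X -> Y) (g : Y -> Z) :
  open_embedding f -> open_embedding g -> open_embedding (g \o f).
Proof.
move=> [cf fi fo] [cg gi go]; split.
- by move=> x; apply: continuous_comp; [exact: cf|exact: cg].
- exact: inj_comp.
- by move=> U oU; rewrite -image_comp; apply: go; exact: fo.
Qed.

Lemma homeo_open_embedding (X Y : topologicalType) (f : X -> Y) :
  is_homeo f -> open_embedding f.
Proof.
move=> [cf [g [cg fK gK]]]; split=> //; first exact: can_inj fK.
move=> U oU; have -> : f @` U = g @^-1` U; last by move/continuousP: cg; exact.
apply/seteqP; split=> [_ [x Ux <-]|y Uy]; first by rewrite /preimage/= fK.
by exists (g y).
Qed.

Lemma homeo_sym (X Y : topologicalType) : homeomorphic X Y -> homeomorphic Y X.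
Proof. by move=> [f [cf [g [cg fK gK]]]]; exists g; split=> //; exists f. Qed.

Lemma open_embedding_range (X Y : topologicalType) (j : X -> Y) :
  open_embedding j -> homeomorphic X (range j).
Proof.
move=> [cj ji jo].
pose f x : range j := @elt _ (range j) (j x) (ex_intro2 _ _ x I erefl).
have gP (y : range j) : exists x, j x = set_val y.
  by have [x _ ?] := set_valP y; exists x.
pose g y := projT1 (cid (gP y)).
have gE y : j (g y) = set_val y by rewrite /g; case: cid.
have fK : cancel f g by move=> x; apply: ji; rewrite gE.
have gK : cancel g f by move=> y; apply: set_val_inj; exact: gE.
exists f; split; first exact: continuous_to_set_type.
exists g; split=> //; apply/continuousP => U oU.
apply/open_set_typeP; exists (j @` U); first exact: jo.
apply/seteqP; split=> [y Uy|y [x Ux xy]]; first by exists (g y) => //; exact: gE.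
by rewrite /preimage/=; have -> : g y = x by apply: ji; rewrite gE.
Qed.

Lemma locally_likeP (E T : topologicalType) (x : T) :
  locally_like E x <-> exists U : set T, [/\ open U, U x &
    exists h : U -> E, open_embedding h].
Proof.
split=> [[U [oU Ux [V [oV [f hf]]]]]|[U [oU Ux [h oh]]]]; exists U; split=> //.
  exists (set_val \o f); apply: open_embedding_comp.
    exact: homeo_open_embedding.
  exact: set_val_open_embedding.
exists (range h); split; last exact: open_embedding_range.
by case: oh => _ _; apply; exact: openT.
Qed.

Lemma locally_like_embed (E T T' : topologicalType) (j : T -> T') (x : T) :
  open_embedding j -> locally_like E (j x) <-> locally_like E x.
Proof.
move=> oj; have [cj ji jo] := oj; split=> /locally_likeP[U [oU Ux [h oh]]].
  apply/locally_likeP; exists (j @^-1` U); split=> //.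
    by move/continuousP: cj; exact.
  pose k (y : j @^-1` U) : U := @elt _ U (j (set_val y)) (set_valP y).
  exists (h \o k); apply: open_embedding_comp oh; split.
  - apply: continuous_to_set_type => y; apply: (@continuous_comp _ _ _ set_val j).
      exact: set_val_continuous.
    exact: cj.
  - by move=> y z yz; apply/set_val_inj/ji; exact: (congr1 set_val yz).
  - move=> _ /open_set_typeP[O oO ->]; apply/open_set_typeP.
    exists (j @` O); first exact: jo.
    apply/seteqP; split=> [_ [y Oy <-]|u [y Oy yu]]; first by exists (set_val y).
    have Uy : (j @^-1` U) y by rewrite /preimage/= yu; exact: set_valP.
    by exists (elt Uy) => //; apply: set_val_inj.
apply/locally_likeP; exists (j @` U); split; [exact: jo|by exists x|].
have /open_embedding_range[f hf] : open_embedding (j \o (set_val : U -> T)).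
  exact: open_embedding_comp (set_val_open_embedding oU) oj.
have UjE : range (j \o (set_val : U -> T)) = j @` U.
  apply/seteqP; split=> [_ [y _ <-]|_ [y Uy <-]].
    by exists (set_val y) => //; exact: set_valP.
  by exists (elt Uy).
rewrite UjE in f hf.
have [g /homeo_open_embedding og] : homeomorphic (j @` U) U.
  by apply: homeo_sym; exists f.
by exists (h \o g); exact: open_embedding_comp og oh.
Qed.

End open_embedding.

Section two_pieces.
Context {T T1 T2 : topologicalType} (j1 : T1 -> T) (j2 : T2 -> T).
Hypotheses (oj1 : open_embedding j1) (oj2 : open_embedding j2).
Hypothesis j12 : forall z, (exists x, z = j1 x) \/ (exists y, z = j2 y).
Hypothesis j1j2 : forall x y, j1 x <> j2 y.

Lemma two_pieces_compact :
  compact [set: T1] -> compact [set: T2] -> compact [set: T].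
Proof.
move=> c1 c2; have -> : [set: T] = (j1 @` setT) `|` (j2 @` setT).
  by apply/seteqP; split=> // z _; case: (j12 z) => -[x ->]; [left|right]; exists x.
have cts (S : topologicalType) (j : S -> T) : open_embedding j ->
    compact [set: S] -> compact (j @` setT).
  move=> [cj _ _]; apply: continuous_compact.
  exact: continuous_subspaceT.
by apply: compactU; exact: cts.
Qed.

Lemma embed_separated (S : topologicalType) (j : S -> T) (x y : S) :
  open_embedding j -> hausdorff_space S -> j x != j y ->
    exists2 AB : set T * set T, (j x \in AB.1 /\ j y \in AB.2) &
                [/\ open AB.1, open AB.2 & AB.1 `&` AB.2 == set0].
Proof.
move=> [_ ji jo]; rewrite open_hausdorff => hS xy.
have /hS[[A B]/= [/set_mem Ax /set_mem By] [oA oB /eqP AB]] : x != y.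
  by apply: contra_neq xy => ->.
exists (j @` A, j @` B) => /=; first by split; apply/mem_set; [exists x|exists y].
split; [exact: jo|exact: jo|apply/eqP].
apply/seteqP; split=> // _ [[u Au <-] [v Bv /ji vu]].
by move: AB => /seteqP[/(_ u) + _]; apply; split=> //; rewrite -vu.
Qed.

Lemma two_pieces_hausdorff :
  hausdorff_space T1 -> hausdorff_space T2 -> hausdorff_space T.
Proof.
move=> h1 h2; rewrite open_hausdorff => z w.
have [_ _ o1] := oj1; have [_ _ o2] := oj2.
have r1 : open (range j1) by apply: o1; exact: openT.
have r2 : open (range j2) by apply: o2; exact: openT.
have d12 : range j1 `&` range j2 = set0.
  by apply/seteqP; split=> // _ [[x _ <-] [y _ /esym/j1j2]].
case: (j12 z) => -[x ->]; case: (j12 w) => -[y ->] ne.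
- exact: embed_separated.
- exists (range j1, range j2) => /=; first by split; apply/mem_set; [exists x|exists y].
  by split=> //; rewrite d12.
- exists (range j2, range j1) => /=; first by split; apply/mem_set; [exists x|exists y].
  by split=> //; rewrite setIC d12.
- exact: embed_separated.
Qed.

Lemma two_pieces_chart (E : topologicalType) :
  (forall x : T1, locally_like E x) -> (forall x : T2, locally_like E x) ->
  forall z : T, locally_like E z.
Proof.
move=> l1 l2 z; case: (j12 z) => -[x ->].
  exact/(locally_like_embed _ _ oj1).
exact/(locally_like_embed _ _ oj2).
Qed.

Lemma two_pieces_closed (R : realType) (n : nat) :
  closed_manifold R n T1 -> closed_manifold R n T2 -> closed_manifold R n T.
Proof.
move=> [c1 h1 l1] [c2 h2 l2]; split.
- exact: two_pieces_compact.
- exact: two_pieces_hausdorff.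
- exact: two_pieces_chart.
Qed.

Lemma two_pieces_manifold (R : realType) (n : nat) :
  compact_manifold R n T1 -> compact_manifold R n T2 -> compact_manifold R n T.
Proof.
move=> [c1 h1 l1] [c2 h2 l2]; split.
- exact: two_pieces_compact.
- exact: two_pieces_hausdorff.
- exact: two_pieces_chart.
Qed.

End two_pieces.

Section dset.
Context {X Y : topologicalType}.

Definition dset (A : set X) (B : set Y) : set (X + Y)%type :=
  [set z | match z with inl x => A x | inr y => B y end].

Definition dinl (A : set X) (B : set Y) (x : A) : dset A B :=
  @elt _ (dset A B) (inl (set_val x)) (set_valP x).

Definition dinr (A : set X) (B : set Y) (y : B) : dset A B :=
  @elt _ (dset A B) (inr (set_val y)) (set_valP y).

Lemma dsetU (A A' : set X) (B B' : set Y) :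
  dset A B `|` dset A' B' = dset (A `|` A') (B `|` B').
Proof. by apply/seteqP; split=> -[]. Qed.

Lemma dsetI (A A' : set X) (B B' : set Y) :
  dset A B `&` dset A' B' = dset (A `&` A') (B `&` B').
Proof. by apply/seteqP; split=> -[]. Qed.

Lemma dset0 : dset set0 set0 = set0.
Proof. by apply/seteqP; split=> -[]. Qed.

Lemma dsetSl (A : set X) (B : set Y) : dset A set0 `<=` dset A B.
Proof. by move=> []. Qed.

Lemma dsetSr (A : set X) (B : set Y) : dset set0 B `<=` dset A B.
Proof. by move=> []. Qed.

Lemma dinl_embedding (A : set X) (B : set Y) : open_embedding (@dinl A B).
Proof.
split.
- apply: continuous_to_set_type; apply/continuousP => U [Ul _].
  by apply/open_set_typeP; exists (inl @^-1` U).
- by move=> x y xy; apply: set_val_inj; have [] := congr1 set_val xy.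
- move=> _ /open_set_typeP[O oO ->]; apply/open_set_typeP.
  exists (dset O set0).
    by split; [exact: oO|exact: open0].
  apply/seteqP; split=> [_ [x Ox <-]//|z].
  have dz : dset A B (set_val z) := set_valP z.
  rewrite /preimage/=; case E : (set_val z) dz => [x|y]//= Ax Ox.
  by exists (elt Ax) => //; apply: set_val_inj; rewrite E.
Qed.

Lemma dinr_embedding (A : set X) (B : set Y) : open_embedding (@dinr A B).
Proof.
split.
- apply: continuous_to_set_type; apply/continuousP => U [_ Ur].
  by apply/open_set_typeP; exists (inr @^-1` U).
- by move=> x y xy; apply: set_val_inj; have [] := congr1 set_val xy.
- move=> _ /open_set_typeP[O oO ->]; apply/open_set_typeP.
  exists (dset set0 O).
    by split; [exact: open0|exact: oO].
  apply/seteqP; split=> [_ [y Oy <-]//|z].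
  have dz : dset A B (set_val z) := set_valP z.
  rewrite /preimage/=; case E : (set_val z) dz => [x|y]//= By Oy.
  by exists (elt By) => //; apply: set_val_inj; rewrite E.
Qed.

Lemma dset_cover (A : set X) (B : set Y) (z : dset A B) :
  (exists x, z = @dinl A B x) \/ (exists y, z = @dinr A B y).
Proof.
have dz : dset A B (set_val z) := set_valP z.
case E : (set_val z) dz => [x|y] h; [left|right].
  by exists (@elt _ A x h); apply: set_val_inj; rewrite E.
by exists (@elt _ B y h); apply: set_val_inj; rewrite E.
Qed.

Lemma dinl_dinr (A : set X) (B : set Y) x y : @dinl A B x <> @dinr A B y.
Proof. by move=> /(congr1 set_val). Qed.

Lemma dinl_homeo (A : set X) : is_homeo (@dinl A set0).
Proof.
have [dc di dop] := dinl_embedding A set0; split=> //.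
have gP (z : dset A set0) : exists x, dinl set0 x = z.
  by have [[x ->]|[y _]] := dset_cover z; [exists x|case: (set_valP y)].
pose g z := projT1 (cid (gP z)).
have gE z : dinl set0 (g z) = z by rewrite /g; case: cid.
exists g; split=> //; last by move=> x; apply: di; exact: gE.
apply/continuousP => U /dop; congr open; apply/seteqP; split=> [_ [x Ux <-]|z Uz].
  by rewrite /preimage/=; have -> : g (dinl set0 x) = x by apply: di; exact: gE.
by exists (g z).
Qed.

Lemma dinr_homeo (B : set Y) : is_homeo (@dinr set0 B).
Proof.
have [dc di dop] := dinr_embedding set0 B; split=> //.
have gP (z : dset set0 B) : exists y, dinr set0 y = z.
  by have [[x _]|[y ->]] := dset_cover z; [case: (set_valP x)|exists y].
pose g z := projT1 (cid (gP z)).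
have gE z : dinr set0 (g z) = z by rewrite /g; case: cid.
exists g; split=> //; last by move=> x; apply: di; exact: gE.
apply/continuousP => U /dop; congr open; apply/seteqP; split=> [_ [x Ux <-]|z Uz].
  by rewrite /preimage/=; have -> : g (dinr set0 x) = x by apply: di; exact: gE.
by exists (g z).
Qed.

End dset.

(* A closed n-manifold, or a bordism, is a subset of an arbitrary ambient
   topological space, with the subspace topology.  Submanifolds are then
   literally subsets and restricting in stages needs no identifications.
   Homeomorphisms relate subsets of possibly different ambient spaces. *)

Section bordisms.
Context (R : realType) (n : nat).

Record closed_mfd (X : topologicalType) := ClosedMfd {
  mfd_set :> set X;
  mfd_closed : closed_manifold R n mfd_set }.

Record bordism (X : topologicalType) := Bordism {
  bord_set :> set X;
  bord_in : closed_mfd X;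
  bord_out : closed_mfd X;
  bord_manifold : compact_manifold R n bord_set;
  bord_boundaryE : set_val @` manifold_boundary R n bord_set =
                   bord_in `|` bord_out;
  bord_disjoint : bord_in `&` bord_out = set0 }.

Lemma closed_mfd_eq (X : topologicalType) (M N : closed_mfd X) :
  M = N :> set X -> M = N.
Proof.
by case: M N => [M hM] [N hN] /= MN; subst N; congr ClosedMfd; exact: Prop_irrelevance.
Qed.

Lemma closed_mfd0_subproof (X : topologicalType) :
  closed_manifold R n (set0 : set X).
Proof.
split=> [| |x]; [|move=> x|]; try by case: (set_valP x).
have -> : [set: (set0 : set X)] = set0; last exact: compact0.
by apply/seteqP; split=> // x; case: (set_valP x).
Qed.

Definition closed_mfd0 (X : topologicalType) : closed_mfd X :=
  ClosedMfd (closed_mfd0_subproof X).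

Lemma bordism0_subproof (X : topologicalType) :
  compact_manifold R n (set0 : set X) /\
  set_val @` manifold_boundary R n (set0 : set X) = set0 `|` set0.
Proof.
split; last first.
  by rewrite setU0; apply/seteqP; split=> // y [x _ _]; exact: (False_ind _ (set_valP x)).
split=> [| |x]; [|move=> x|]; try by case: (set_valP x).
have -> : [set: (set0 : set X)] = set0; last exact: compact0.
by apply/seteqP; split=> // x; case: (set_valP x).
Qed.

Definition bordism0 (X : topologicalType) : bordism X :=
  @Bordism X set0 (closed_mfd0 X) (closed_mfd0 X)
    (bordism0_subproof X).1 (bordism0_subproof X).2 (setI0 _).

Lemma bord_in_sub (X : topologicalType) (W : bordism X) : bord_in W `<=` W.
Proof.
move=> x Wx; have : (bord_in W `|` bord_out W) x by left.
by rewrite -bord_boundaryE => -[y _ <-]; exact: set_valP.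
Qed.

Lemma bord_out_sub (X : topologicalType) (W : bordism X) : bord_out W `<=` W.
Proof.
move=> x Wx; have : (bord_in W `|` bord_out W) x by right.
by rewrite -bord_boundaryE => -[y _ <-]; exact: set_valP.
Qed.

Lemma hausdorff_inj (T T' : topologicalType) (f : T -> T') :
  continuous f -> injective f -> hausdorff_space T' -> hausdorff_space T.
Proof.
rewrite !open_hausdorff => /continuousP cf fi hT' x y xy.
have /hT'[[A B]/= [/set_mem Ax /set_mem By] [oA oB /eqP AB]] : f x != f y.
  by apply: contra_neq xy => /fi.
exists (f @^-1` A, f @^-1` B) => /=; first by split; apply/mem_set.
by split; [exact: cf|exact: cf|rewrite -preimage_setI AB preimage_set0].
Qed.

Lemma incl_clopen_embedding (X : topologicalType) (A B : set X) :
  hausdorff_space (A `|` B : set X) -> A `&` B = set0 ->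
  compact [set: B] -> open_embedding (incl (@subsetUl _ A B)).
Proof.
move=> hAB AB cB; split; [exact: incl_continuous|exact: incl_inj|].
set j := incl _; pose j' := incl (@subsetUr _ A B).
have oA : open (~` (range j')).
  apply: closed_openC; apply: compact_closed => //.
  apply: continuous_compact => //; apply: continuous_subspaceT.
  exact: incl_continuous.
move=> _ /open_set_typeP[O oO ->].
have -> : j @` (set_val @^-1` O) = (set_val @^-1` O) `&` ~` (range j').
  apply/seteqP; split=> [_ [x Ox <-]|x [Ox nx]].
    split=> // -[y _ /(congr1 set_val) yx].
    have yx' : set_val y = set_val x := yx.
    have : (A `&` B) (set_val x).
      by split; [exact: set_valP|rewrite -yx'; exact: set_valP].
    by rewrite AB.
  have [Ax|Bx] := set_valP x; last first.
    by case: nx; exists (elt Bx) => //; apply: set_val_inj.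
  by exists (elt Ax) => //; apply: set_val_inj.
apply: openI => //; apply/open_set_typeP; by exists O.
Qed.

Lemma bord_boundary_subproof (X : topologicalType) (W : bordism X) :
  closed_manifold R n (bord_in W `|` bord_out W).
Proof.
have sW : bord_in W `|` bord_out W `<=` W.
  by rewrite subUset; split; [exact: bord_in_sub|exact: bord_out_sub].
have hU : hausdorff_space (bord_in W `|` bord_out W : set X).
  apply: (hausdorff_inj (@incl_continuous _ _ _ sW)); first exact: incl_inj.
  exact: compact_manifold_hausdorff (bord_manifold W).
have [c1 _ _] := mfd_closed (bord_in W).
have [c2 _ _] := mfd_closed (bord_out W).
have e1 : open_embedding (incl (@subsetUl _ (bord_in W) (bord_out W))).
  exact: incl_clopen_embedding hU (bord_disjoint W) c2.
have e2 : open_embedding (incl (@subsetUr _ (bord_in W) (bord_out W))).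
  have h : forall (C : set X) (sC : bord_out W `<=` C),
      C = bord_out W `|` bord_in W -> open_embedding (incl sC).
    move=> C sC CE; subst C.
    rewrite (_ : sC = @subsetUl _ _ _); last exact: Prop_irrelevance.
    apply: incl_clopen_embedding; [by rewrite setUC| |exact: c1].
    by rewrite setIC; exact: bord_disjoint.
  by apply: h; rewrite setUC.
apply: (two_pieces_closed e1 e2); [| |exact: mfd_closed|exact: mfd_closed].
- move=> z; have [zi|zo] := set_valP z; [left|right].
    by exists (elt zi); apply: set_val_inj.
  by exists (elt zo); apply: set_val_inj.
- move=> x y /(congr1 set_val) xy.
  have xy' : set_val x = set_val y := xy.
  have : (bord_in W `&` bord_out W) (set_val x).
    by split; [exact: set_valP|rewrite xy'; exact: set_valP].
  by rewrite bord_disjoint.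
Qed.

Definition bord_boundary (X : topologicalType) (W : bordism X) : closed_mfd X :=
  ClosedMfd (bord_boundary_subproof W).

Lemma bord_boundary_sub (X : topologicalType) (W : bordism X) :
  bord_boundary W `<=` W.
Proof. by rewrite subUset; split; [exact: bord_in_sub|exact: bord_out_sub]. Qed.

Section dunion.
Context {X Y : topologicalType}.

Lemma mfd_dunion_subproof (M : closed_mfd X) (N : closed_mfd Y) :
  closed_manifold R n (dset M N).
Proof.
apply: (two_pieces_closed (dinl_embedding M N) (dinr_embedding M N)).
- exact: dset_cover.
- exact: dinl_dinr.
- exact: mfd_closed.
- exact: mfd_closed.
Qed.

Definition mfd_dunion (M : closed_mfd X) (N : closed_mfd Y) :
  closed_mfd (X + Y)%type := ClosedMfd (mfd_dunion_subproof M N).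

Lemma bord_dunion_manifold (W : bordism X) (W' : bordism Y) :
  compact_manifold R n (dset W W').
Proof.
apply: (two_pieces_manifold (dinl_embedding W W') (dinr_embedding W W')).
- exact: dset_cover.
- exact: dinl_dinr.
- exact: bord_manifold.
- exact: bord_manifold.
Qed.

Lemma bord_dunion_boundary (W : bordism X) (W' : bordism Y) :
  set_val @` manifold_boundary R n (dset W W') =
  dset (bord_in W) (bord_in W') `|` dset (bord_out W) (bord_out W').
Proof.
rewrite dsetU -!bord_boundaryE; apply/seteqP; split=> [_ [z bz <-]|[x|y]/=].
- have [[x zx]|[y zy]] := dset_cover z; subst z => /=.
    by exists x => // /(locally_like_embed _ _ (dinl_embedding W W')).
  by exists y => // /(locally_like_embed _ _ (dinr_embedding W W')).
- move=> [u bu <-]; exists (dinl W' u) => //.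
  by move=> /(locally_like_embed _ _ (dinl_embedding W W')).
- move=> [u bu <-]; exists (dinr W u) => //.
  by move=> /(locally_like_embed _ _ (dinr_embedding W W')).
Qed.

Lemma bord_dunion_disjoint (W : bordism X) (W' : bordism Y) :
  dset (bord_in W) (bord_in W') `&` dset (bord_out W) (bord_out W') = set0.
Proof. by rewrite dsetI !bord_disjoint dset0. Qed.

Definition bord_dunion (W : bordism X) (W' : bordism Y) :
  bordism (X + Y)%type :=
  @Bordism _ (dset W W')
    (mfd_dunion (bord_in W) (bord_in W'))
    (mfd_dunion (bord_out W) (bord_out W'))
    (bord_dunion_manifold W W') (bord_dunion_boundary W W')
    (bord_dunion_disjoint W W').

(* The canonical identification of \partial (W \sqcup W') with
   \partial W \sqcup \partial W' is an equality of subsets of X + Y. *)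
Lemma bord_boundary_dunion (W : bordism X) (W' : bordism Y) :
  mfd_dunion (bord_boundary W) (bord_boundary W') =
  bord_boundary (bord_dunion W W').
Proof. by apply: closed_mfd_eq; rewrite /= dsetU. Qed.

End dunion.

Record subbordism (X : topologicalType) (W0 W : bordism X) : Prop := {
  subbord_sub : W0 `<=` W;
  subbord_in : forall x, mfd_set (bord_in W0) x ->
    let C := connected_component (bord_in W0) x in
    C `&` bord_boundary W = set0 \/ C `<=` bord_in W;
  subbord_out : forall x, mfd_set (bord_out W0) x ->
    let C := connected_component (bord_out W0) x in
    C `&` bord_boundary W = set0 \/ C `<=` bord_out W }.

(* W = W' \cup_N W'' with N the outgoing boundary of W' and the incoming
   boundary of W''.  As W' and W'' are compact and W is Hausdorff, the subspace
   topology on their union is the gluing topology. *)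
Record is_gluing (X : topologicalType) (W' W'' W : bordism X) : Prop := {
  gluing_mid : bord_out W' = bord_in W'';
  gluing_set : W = W' `|` W'' :> set X;
  gluing_meet : W' `&` W'' = bord_out W';
  gluing_in : bord_in W = bord_in W';
  gluing_out : bord_out W = bord_out W'' }.

Definition bord_homeo (X Y : topologicalType) (W : bordism X) (V : bordism Y)
    (phi : W -> V) : Prop :=
  [/\ is_homeo phi,
      forall x, mfd_set (bord_in W) (set_val x) <->
                mfd_set (bord_in V) (set_val (phi x)) &
      forall x, mfd_set (bord_out W) (set_val x) <->
                mfd_set (bord_out V) (set_val (phi x))].

Lemma subbord_dunionl (X Y : topologicalType) (W : bordism X) (W' : bordism Y) :
  subbordism (bord_dunion W (bordism0 Y)) (bord_dunion W W').
Proof.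
split; first exact: dsetSl.
- move=> x _; right; apply: subset_trans (@dsetSl _ _ _ _).
  exact: connected_component_sub.
- move=> x _; right; apply: subset_trans (@dsetSl _ _ _ _).
  exact: connected_component_sub.
Qed.

Lemma subbord_dunionr (X Y : topologicalType) (W : bordism X) (W' : bordism Y) :
  subbordism (bord_dunion (bordism0 X) W') (bord_dunion W W').
Proof.
split; first exact: dsetSr.
- move=> x _; right; apply: subset_trans (@dsetSr _ _ _ _).
  exact: connected_component_sub.
- move=> x _; right; apply: subset_trans (@dsetSr _ _ _ _).
  exact: connected_component_sub.
Qed.

Lemma bord_homeo_inl (X Y : topologicalType) (W : bordism X) :
  @bord_homeo X _ W (bord_dunion W (bordism0 Y)) (@dinl X Y W set0).
Proof. by split=> //; exact: dinl_homeo. Qed.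

Lemma bord_homeo_inr (X Y : topologicalType) (W' : bordism Y) :
  @bord_homeo Y _ W' (bord_dunion (bordism0 X) W') (@dinr X Y set0 W').
Proof. by split=> //; exact: dinr_homeo. Qed.

Section gluing.
Context (X : topologicalType) (W' W'' W : bordism X).
Hypothesis g : is_gluing W' W'' W.

Lemma gluing_subl : subbordism W' W.
Proof.
case: g => mid sE _ iE oE; split; first by rewrite sE; exact: subsetUl.
  by move=> x _; right; rewrite iE; exact: connected_component_sub.
move=> x _; left; apply/seteqP; split=> // y [/connected_component_sub Wy] /=.
rewrite iE oE => -[iy|oy].
  by have : (bord_in W' `&` bord_out W') y by []; rewrite bord_disjoint.
rewrite mid in Wy.
by have : (bord_in W'' `&` bord_out W'') y by []; rewrite bord_disjoint.
Qed.

Lemma gluing_subr : subbordism W'' W.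
Proof.
case: g => mid sE _ iE oE; split; first by rewrite sE; exact: subsetUr.
  move=> x _; left; apply/seteqP; split=> // y [/connected_component_sub Wy] /=.
  rewrite iE oE => -[iy|oy].
    rewrite -mid in Wy.
    by have : (bord_in W' `&` bord_out W') y by []; rewrite bord_disjoint.
  by have : (bord_in W'' `&` bord_out W'') y by []; rewrite bord_disjoint.
by move=> x _; right; rewrite oE; exact: connected_component_sub.
Qed.

Lemma gluing_mid_sub : bord_out W' `<=` W''.
Proof. by rewrite (gluing_mid g); exact: bord_in_sub. Qed.

End gluing.
End bordisms.
Arguments closed_mfd0 : clear implicits.
Arguments bordism0 : clear implicits.

Section fields.
Context (R : realType) (n : nat).
Local Notation bordism := (bordism R n).
Local Notation closed_mfd := (closed_mfd R n).

Record field_data := FieldData {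
  fieldB : forall X : topologicalType, bordism X -> Type;
  fieldM : forall X : topologicalType, closed_mfd X -> Type;
  resBB : forall (X : topologicalType) (W0 W : bordism X),
    subbordism W0 W -> fieldB W -> fieldB W0;
  resBM : forall (X : topologicalType) (M : closed_mfd X) (W : bordism X),
    M `<=` W -> fieldB W -> fieldM M;
  resMM : forall (X : topologicalType) (M0 M : closed_mfd X),
    M0 `<=` M -> fieldM M -> fieldM M0;
  pullB : forall (X Y : topologicalType) (W : bordism X) (V : bordism Y)
    (phi : W -> V), bord_homeo phi -> fieldB V -> fieldB W;
  pullM : forall (X Y : topologicalType) (M : closed_mfd X) (N : closed_mfd Y)
    (phi : M -> N), is_homeo phi -> fieldM N -> fieldM M }.

Section summands.
Context (F : field_data) {X Y : topologicalType}.

(* Restriction to a summand of an ordered disjoint union: restrict to the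
   copy W \sqcup \emptyset of W inside W \sqcup W' and identify it with W. *)
Definition resBl (W : bordism X) (W' : bordism Y)
    (f : fieldB F (bord_dunion W W')) : fieldB F W :=
  pullB (bord_homeo_inl Y W) (resBB (subbord_dunionl W W') f).

Definition resBr (W : bordism X) (W' : bordism Y)
    (f : fieldB F (bord_dunion W W')) : fieldB F W' :=
  pullB (bord_homeo_inr X W') (resBB (subbord_dunionr W W') f).

Definition resMl (M : closed_mfd X) (N : closed_mfd Y)
    (f : fieldM F (mfd_dunion M N)) : fieldM F M :=
  @pullM F _ _ M (mfd_dunion M (closed_mfd0 R n Y)) _ (dinl_homeo M)
    (@resMM F _ (mfd_dunion M (closed_mfd0 R n Y)) (mfd_dunion M N)
       (@dsetSl X Y M N) f).

Definition resMr (M : closed_mfd X) (N : closed_mfd Y)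
    (f : fieldM F (mfd_dunion M N)) : fieldM F N :=
  @pullM F _ _ N (mfd_dunion (closed_mfd0 R n X) N) _ (dinr_homeo N)
    (@resMM F _ (mfd_dunion (closed_mfd0 R n X) N) (mfd_dunion M N)
       (@dsetSr X Y M N) f).

End summands.

Record field_axioms (F : field_data) : Prop := {
  fieldB0 : forall X : topologicalType,
    exists p : fieldB F (bordism0 R n X), forall q, q = p;
  fieldM0 : forall X : topologicalType,
    exists p : fieldM F (closed_mfd0 R n X), forall q, q = p;
  res_BBB : forall (X : topologicalType) (W1 W0 W : bordism X)
    (s10 : subbordism W1 W0) (s0 : subbordism W0 W) (s1 : subbordism W1 W)
    (f : fieldB F W), resBB s10 (resBB s0 f) = resBB s1 f;
  res_BBM : forall (X : topologicalType) (M : closed_mfd X) (W0 W : bordism X)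
    (sM0 : M `<=` W0) (s0 : subbordism W0 W) (sM : M `<=` W)
    (f : fieldB F W), resBM sM0 (resBB s0 f) = resBM sM f;
  res_BMM : forall (X : topologicalType) (M0 M : closed_mfd X) (W : bordism X)
    (s0 : M0 `<=` M) (sM : M `<=` W) (s0W : M0 `<=` W)
    (f : fieldB F W), resMM s0 (resBM sM f) = resBM s0W f;
  res_MMM : forall (X : topologicalType) (M1 M0 M : closed_mfd X)
    (s10 : M1 `<=` M0) (s0 : M0 `<=` M) (s1 : M1 `<=` M)
    (f : fieldM F M), resMM s10 (resMM s0 f) = resMM s1 f;
  pullB_bij : forall (X Y : topologicalType) (W : bordism X) (V : bordism Y)
    (phi : W -> V) (h : bord_homeo phi), bijective (@pullB F _ _ _ _ _ h);
  pullB_id : forall (X : topologicalType) (W : bordism X)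
    (h : @bord_homeo _ _ _ _ W W id) (f : fieldB F W), pullB h f = f;
  pullB_comp : forall (X Y Z : topologicalType)
    (W : bordism X) (V : bordism Y) (U : bordism Z)
    (phi : W -> V) (psi : V -> U) (hphi : bord_homeo phi)
    (hpsi : bord_homeo psi) (h : @bord_homeo _ _ _ _ W U (psi \o phi))
    (f : fieldB F U), pullB h f = pullB hphi (pullB hpsi f);
  pullM_bij : forall (X Y : topologicalType)
    (M : closed_mfd X) (N : closed_mfd Y)
    (phi : M -> N) (h : is_homeo phi), bijective (@pullM F _ _ _ _ _ h);
  pullM_id : forall (X : topologicalType) (M : closed_mfd X)
    (h : is_homeo (id : M -> M)) (f : fieldM F M), pullM h f = f;
  pullM_comp : forall (X Y Z : topologicalType)
    (M : closed_mfd X) (N : closed_mfd Y) (P : closed_mfd Z)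
    (phi : M -> N) (psi : N -> P) (hphi : is_homeo phi) (hpsi : is_homeo psi)
    (h : is_homeo (psi \o phi : M -> P)) (f : fieldM F P),
    pullM h f = pullM hphi (pullM hpsi f);
  pull_resBB : forall (X Y : topologicalType)
    (W0 W : bordism X) (V0 V : bordism Y)
    (sW : subbordism W0 W) (sV : subbordism V0 V)
    (phi : W -> V) (phi0 : W0 -> V0)
    (h : bord_homeo phi) (h0 : bord_homeo phi0),
    (forall (x0 : W0) (x : W), set_val x0 = set_val x ->
       set_val (phi0 x0) = set_val (phi x)) ->
    forall f : fieldB F V, resBB sW (pullB h f) = pullB h0 (resBB sV f);
  pull_resBM : forall (X Y : topologicalType)
    (M : closed_mfd X) (W : bordism X) (N : closed_mfd Y) (V : bordism Y)
    (sM : M `<=` W) (sN : N `<=` V)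
    (phi : W -> V) (psi : M -> N) (h : bord_homeo phi) (h0 : is_homeo psi),
    (forall (x0 : M) (x : W), set_val x0 = set_val x ->
       set_val (psi x0) = set_val (phi x)) ->
    forall f : fieldB F V, resBM sM (pullB h f) = pullM h0 (resBM sN f);
  pull_resMM : forall (X Y : topologicalType)
    (M0 M : closed_mfd X) (N0 N : closed_mfd Y)
    (sM : M0 `<=` M) (sN : N0 `<=` N)
    (phi : M -> N) (phi0 : M0 -> N0) (h : is_homeo phi) (h0 : is_homeo phi0),
    (forall (x0 : M0) (x : M), set_val x0 = set_val x ->
       set_val (phi0 x0) = set_val (phi x)) ->
    forall f : fieldM F N, resMM sM (pullM h f) = pullM h0 (resMM sN f);
  fdisjB : forall (X Y : topologicalType) (W : bordism X) (W' : bordism Y),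
    bijective (fun f : fieldB F (bord_dunion W W') => (resBl f, resBr f));
  fdisjM : forall (X Y : topologicalType) (M : closed_mfd X) (N : closed_mfd Y),
    bijective (fun f : fieldM F (mfd_dunion M N) => (resMl f, resMr f));
  fglue : forall (X : topologicalType) (W' W'' W : bordism X)
    (g : is_gluing W' W'' W) (f' : fieldB F W') (f'' : fieldB F W''),
    resBM (@bord_out_sub _ _ _ W') f' = resBM (gluing_mid_sub g) f'' ->
    exists! f : fieldB F W,
      resBB (gluing_subl g) f = f' /\ resBB (gluing_subr g) f = f'' }.

Record fields := Fields {
  fields_data :> field_data;
  fieldsP : field_axioms fields_data }.

End fields.

(* A small strict monoidal category, presented by its set of objects and its
   set Mor(C) of all morphisms. *)
Record strict_monoidal := StrictMonoidal {
  obj : Type;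
  mor : Type;
  src : mor -> obj;
  tgt : mor -> obj;
  idm : obj -> mor;
  comp : forall g f : mor, tgt f = src g -> mor;
  tenO : obj -> obj -> obj;
  unitO : obj;
  ten : mor -> mor -> mor;
  src_idm : forall a, src (idm a) = a;
  tgt_idm : forall a, tgt (idm a) = a;
  src_comp : forall g f e, src (@comp g f e) = src f;
  tgt_comp : forall g f e, tgt (@comp g f e) = tgt g;
  comp_idl : forall f e, @comp (idm (tgt f)) f e = f;
  comp_idr : forall f e, @comp f (idm (src f)) e = f;
  compA : forall h g f e1 e2 e3 e4,
    @comp h (@comp g f e1) e2 = @comp (@comp h g e3) f e4;
  src_ten : forall f g, src (ten f g) = tenO (src f) (src g);
  tgt_ten : forall f g, tgt (ten f g) = tenO (tgt f) (tgt g);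
  ten_idm : forall a b, ten (idm a) (idm b) = idm (tenO a b);
  ten_comp : forall g f g' f' e e' e'',
    ten (@comp g f e) (@comp g' f' e') = @comp (ten g g') (ten f f') e'';
  tenOA : associative tenO;
  tenO1l : left_id unitO tenO;
  tenO1r : right_id unitO tenO;
  tenA : associative ten;
  ten1l : left_id (idm unitO) ten;
  ten1r : right_id (idm unitO) ten }.
Arguments comp {s} g f e.

HB.mixin Record isCompleteMonoid M of GRing.Nmodule M := {
  csum : forall I : Type, (I -> M) -> M;
  csum_empty : forall (I : Type) (m : I -> M), (I -> False) -> csum I m = 0;
  csum_single : forall (I : Type) (m : I -> M) (i0 : I),
    (forall i, i = i0) -> csum I m = m i0;
  csum_pair : forall (I : Type) (m : I -> M) (i1 i2 : I),
    i1 <> i2 -> (forall i, i = i1 \/ i = i2) -> csum I m = m i1 + m i2;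
  csum_partition : forall (I J : Type) (P : J -> I -> Prop) (m : I -> M),
    (forall i, exists! j, P j i) ->
    csum J (fun j => csum {i | P j i} (fun i => m (sval i))) = csum I m }.

#[short(type="completeMonoidType")]
HB.structure Definition CompleteMonoid :=
  {M of GRing.Nmodule M & isCompleteMonoid M}.

Arguments csum {_ I} m.

HB.mixin Record CompleteMonoid_isCompleteSemiRing S
    of GRing.PzSemiRing S & CompleteMonoid S := {
  csumMl : forall (I : Type) (s : S) (m : I -> S),
    csum (fun i => s * m i) = s * csum m;
  csumMr : forall (I : Type) (s : S) (m : I -> S),
    csum (fun i => m i * s) = csum m * s }.

#[short(type="completeSemiRingType")]
HB.structure Definition CompleteSemiRing :=
  {S of GRing.PzSemiRing S & CompleteMonoid S &
        CompleteMonoid_isCompleteSemiRing S}.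

Section pointwise_summation.
Context {T : Type} {M : completeMonoidType}.

Definition fct_csum (I : Type) (m : I -> T -> M) : T -> M :=
  fun t => csum (fun i => m i t).

Let fct_csum_empty (I : Type) (m : I -> T -> M) :
  (I -> False) -> fct_csum m = 0.
Proof. by move=> I0; apply/funext => t; exact: csum_empty. Qed.

Let fct_csum_single (I : Type) (m : I -> T -> M) (i0 : I) :
  (forall i, i = i0) -> fct_csum m = m i0.
Proof.
by move=> h; apply/funext => t; exact: (@csum_single M I (fun i => m i t) i0 h).
Qed.

Let fct_csum_pair (I : Type) (m : I -> T -> M) (i1 i2 : I) :
  i1 <> i2 -> (forall i, i = i1 \/ i = i2) -> fct_csum m = m i1 + m i2.
Proof.
by move=> h1 h2; apply/funext => t; exact: (@csum_pair M I (fun i => m i t) i1 i2 h1 h2).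
Qed.

Let fct_csum_partition (I J : Type) (P : J -> I -> Prop) (m : I -> T -> M) :
  (forall i, exists! j, P j i) ->
  fct_csum (fun j => fct_csum (fun i : {i | P j i} => m (sval i))) = fct_csum m.
Proof.
by move=> h; apply/funext => t; exact: (@csum_partition M I J P (fun i => m i t) h).
Qed.

HB.instance Definition _ := isCompleteMonoid.Build (T -> M)
  fct_csum_empty fct_csum_single fct_csum_pair fct_csum_partition.

End pointwise_summation.

Section monoidal_semiring.
Context (S : completeSemiRingType) (C : strict_monoidal).

(* The product of the monoidal semiring Q^m on Q = (mor C -> S); the factors
   appear in the order b(beta) a(alpha). *)
Definition qtimes (a b : mor C -> S) : mor C -> S := fun gamma =>
  csum (fun p : {p : mor C * mor C | ten p.1 p.2 = gamma} =>
    b (sval p).2 * a (sval p).1).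

Definition qchar (g : mor C) : mor C -> S :=
  fun gamma => if `[< gamma = g >] then 1 else 0.

End monoidal_semiring.

Section actions.
Context (R : realType) (n : nat) (F : fields R n) (C : strict_monoidal).

Record action_axioms
    (T : forall (X : topologicalType) (W : bordism R n X), fieldB F W -> mor C) :
    Prop := {
  action0 : forall (X : topologicalType) (p : fieldB F (bordism0 R n X)),
    T X (bordism0 R n X) p = idm (unitO C);
  tdisj : forall (X Y : topologicalType)
    (W : bordism R n X) (W' : bordism R n Y)
    (f : fieldB F (bord_dunion W W')),
    T _ (bord_dunion W W') f = ten (T X W (resBl f)) (T Y W' (resBr f));
  tglue : forall (X : topologicalType) (W' W'' W : bordism R n X)
    (g : is_gluing W' W'' W) (f : fieldB F W),
    exists e : tgt (T X W' (resBB (gluing_subl g) f)) =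
               src (T X W'' (resBB (gluing_subr g) f)),
      T X W f = comp (T X W'' (resBB (gluing_subr g) f))
                     (T X W' (resBB (gluing_subl g) f)) e;
  thomeo : forall (X Y : topologicalType)
    (W : bordism R n X) (W' : bordism R n Y) (phi : W -> W')
    (h : bord_homeo phi) (f : fieldB F W'),
    T X W (pullB h f) = T Y W' f }.

Record actions := Actions {
  action :> forall (X : topologicalType) (W : bordism R n X),
    fieldB F W -> mor C;
  actionsP : action_axioms action }.

Context (S : completeSemiRingType) (T : actions).

Definition fields_over (X : topologicalType) (W : bordism R n X)
    (f : fieldM F (bord_boundary W)) : Type :=
  {G : fieldB F W | resBM (@bord_boundary_sub _ _ _ W) G = f}.

Definition state_sum (X : topologicalType) (W : bordism R n X)
    (f : fieldM F (bord_boundary W)) : mor C -> S :=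
  csum (fun G : fields_over f => qchar S (T X W (sval G))).

End actions.
Arguments state_sum {R n F C} S T {X} W f gamma.

Definition isotopic_to_id (R : realType) (T : topologicalType) (phi : T -> T) :
    Prop :=
  exists H : ((`[0, 1]%classic : set R) * T)%type -> T,
    [/\ continuous H,
        forall t, is_homeo (fun x => H (t, x)),
        forall t x, set_val t = 0 -> H (t, x) = x &
        forall t x, set_val t = 1 -> H (t, x) = phi x].
Arguments isotopic_to_id R {T} phi.

Section isotopy_restriction.

Lemma continuous_pair (S U V : topologicalType) (f : S -> U) (g : S -> V) :
  continuous f -> continuous g -> continuous (fun s => (f s, g s)).
Proof.
move=> cf cg s A [[P Q]/= [nP nQ] PQA].
have nPQ := @filterI _ (nbhs s) (nbhs_filter s) _ _ (cf s P nP) (cg s Q nQ).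
by apply: (@filterS _ (nbhs s) (nbhs_filter s) _ _ _ nPQ) => u [Pu Qu]; exact: PQA.
Qed.

Context {R : realType} {M T : topologicalType} (j : M -> T).
Hypotheses (oj : open_embedding j) (cj : closed (range j)).

Lemma lift_continuous (S : topologicalType) (f : S -> M) :
  continuous (j \o f) -> continuous f.
Proof.
have [_ ji jo] := oj; move=> /continuousP cjf; apply/continuousP => U /jo /cjf.
congr open; apply/seteqP; split=> [s [x Ux /ji xs]|s Us].
  by rewrite /preimage/= -xs.
by exists (f s).
Qed.

Lemma homeo_restrict (psi : T -> T) (psi0 : M -> M) : is_homeo psi ->
  (forall z, range j (psi z) <-> range j z) ->
  (forall x, j (psi0 x) = psi (j x)) -> is_homeo psi0.
Proof.
have [ctj ji _] := oj; move=> [cpsi [g [cg psiK gK]]] psij psi0E.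
have gP x : exists y, j y = g (j x).
  have : range j (psi (g (j x))) by rewrite gK; exists x.
  by move=> /psij[y _ ?]; exists y.
pose g0 x := projT1 (cid (gP x)).
have g0E x : j (g0 x) = g (j x) by rewrite /g0; case: cid.
split.
  apply: lift_continuous; rewrite (_ : _ \o _ = psi \o j).
    by move=> x; apply: continuous_comp; [exact: ctj|exact: cpsi].
  by apply/funext => x /=.
exists g0; split.
- apply: lift_continuous; rewrite (_ : _ \o _ = g \o j).
    by move=> x; apply: continuous_comp; [exact: ctj|exact: cg].
  by apply/funext => x /=.
- by move=> x; apply: ji; rewrite g0E psi0E psiK.
- by move=> x; apply: ji; rewrite psi0E g0E gK.
Qed.

Lemma isotopy_restrict (phi : T -> T) : is_homeo phi -> isotopic_to_id R phi ->
  exists phi0 : M -> M, [/\ is_homeo phi0, isotopic_to_id R phi0 &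
    forall x, j (phi0 x) = phi (j x)].
Proof.
have [ctj ji jo] := oj; move=> hphi [H [cH hH H0 H1]].
have oR : open (range j) by apply: jo; exact: openT.
pose I : set R := `[0, 1]%classic.
have I0 : I 0 by rewrite /I/= in_itv/= lexx ler01.
have I1 : I 1 by rewrite /I/= in_itv/= lexx ler01.
have HR (t : I) z : range j (H (t, z)) <-> range j z.
  pose p (s : I) : T := H (s, z).
  have cp : continuous p.
    have ci : continuous (fun s : I => (s, z)).
      by apply: continuous_pair; [move=> s A|exact: cst_continuous].
    by move=> s; exact: (continuous_comp (ci s) (cH (s, z))).
  pose q : R -> T := valL_ z p.
  have qE (s : I) : q (set_val s) = p s.
    by have /(congr1 (fun f => f s)) := valLK z p.
  have cq : connected (q @` I).
    apply: connected_continuous_connected; first exact: segment_connected.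
    exact/subspace_valL_continuousP'.
  have pI (s : I) : (q @` I) (p s).
    by exists (set_val s); [exact: set_valP|exact: qE].
  have all_in (s u : I) : range j (p s) -> range j (p u).
    move=> js; have := pI u; rewrite -[in X in X -> _](cq (q @` I `&` range j)).
    - by case.
    - by exists (p s); split.
    - by exists (range j).
    - by exists (range j).
  have p0 : p (elt I0) = z by exact: H0.
  by split=> [/(all_in t (elt I0))|jz]; [rewrite p0|apply: (all_in (elt I0)); rewrite p0].
have gP (tx : I * M) : exists y, j y = H (tx.1, j tx.2).
  have [y _ ?] := (HR tx.1 (j tx.2)).2 (ex_intro2 _ _ tx.2 Logic.I erefl).
  by exists y.
pose G tx := projT1 (cid (gP tx)).
have GE tx : j (G tx) = H (tx.1, j tx.2) by rewrite /G; case: cid.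
have GhE (t : I) : is_homeo (fun x => G (t, x)).
  apply: (homeo_restrict (hH t)) => [z|x]; first exact: HR.
  by rewrite GE.
exists (fun x => G (elt I1, x)); split=> //; last first.
  by move=> x; rewrite GE; exact: H1.
exists G; split=> //.
- apply: lift_continuous.
  rewrite (_ : j \o G = H \o (fun tx => (tx.1, j tx.2))); last first.
    by apply/funext => tx /=.
  have c2 : continuous (fun tx : I * M => (tx.1, j tx.2)).
    apply: continuous_pair => tx; first exact: cvg_fst.
    by apply: (@continuous_comp _ _ _ snd j); [exact: cvg_snd|exact: ctj].
  by move=> tx; exact: (continuous_comp (c2 tx) (cH _)).
- by move=> t x t0; apply: ji; rewrite GE; exact: H0.
- move=> t x t1; apply: ji; rewrite !GE; rewrite /= !H1//.
Qed.
End isotopy_restriction.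

Section state_modules.
Context (R : realType) (n : nat) (F : fields R n).
Context (C : strict_monoidal) (S : completeSemiRingType).

Definition state_module (X : topologicalType) (M : closed_mfd R n X) :
    set (fieldM F M -> mor C -> S) :=
  [set z | forall (phi : M -> M) (h : is_homeo phi), isotopic_to_id R phi ->
    forall f, z (pullM h f) = z f].

(* z \widehat{\otimes}_m z' is (f, g) |-> z f \times z' g; here it is composed
   with the identification f |-> (f|_M, f|_N) of fields on M \sqcup N. *)
Definition state_tensor (X Y : topologicalType)
    (M : closed_mfd R n X) (N : closed_mfd R n Y)
    (z : fieldM F M -> mor C -> S) (z' : fieldM F N -> mor C -> S) :
    fieldM F (mfd_dunion M N) -> mor C -> S :=
  fun f => qtimes (z (resMl f)) (z' (resMr f)).

Lemma homeo_comp (X Y Z : topologicalType) (f : X -> Y) (g : Y -> Z) :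
  is_homeo f -> is_homeo g -> is_homeo (g \o f).
Proof.
move=> [cf [f' [cf' fK f'K]]] [cg [g' [cg' gK g'K]]]; split.
  by move=> x; apply: continuous_comp; [exact: cf|exact: cg].
exists (f' \o g'); split.
- by move=> x; apply: continuous_comp; [exact: cg'|exact: cf'].
- exact: can_comp.
- exact: can_comp.
Qed.

Lemma pullM_eq (X Y : topologicalType)
    (M : closed_mfd R n X) (N : closed_mfd R n Y) (phi psi : M -> N)
    (h : is_homeo phi) (k : is_homeo psi) (f : fieldM F N) :
  phi =1 psi -> pullM h f = pullM k f.
Proof.
by move=> /funext e; subst psi; rewrite (Prop_irrelevance h k).
Qed.

Lemma pull_res_homeo (X Y : topologicalType) (M : closed_mfd R n X)
    (D K : closed_mfd R n Y) (sD : D `<=` K)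
    (j : M -> D) (hj : is_homeo j)
    (phi : K -> K) (h : is_homeo phi) (phi0 : M -> M) (h0 : is_homeo phi0)
    (f : fieldM F K) :
  (forall x, incl sD (j (phi0 x)) = phi (incl sD (j x))) ->
  pullM hj (resMM sD (pullM h f)) = pullM h0 (pullM hj (resMM sD f)).
Proof.
move=> E; have FP := fieldsP F.
have [cj [g [cg jK gK]]] := hj.
have hg : is_homeo g by split=> //; exists j.
have h1 : is_homeo (j \o phi0 \o g) by apply: homeo_comp => //; exact: homeo_comp.
rewrite (pull_resMM FP sD sD h h1); last first.
  move=> x0 x x0x; have -> : x = incl sD (j (g x0)).
    by rewrite gK; apply: set_val_inj; rewrite -x0x.
  by rewrite -E.
have h2 : is_homeo (j \o phi0) by exact: homeo_comp.
rewrite -(pullM_comp FP h0 hj h2).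
have h3 : is_homeo ((j \o phi0 \o g) \o j) by exact: homeo_comp.
rewrite -(pullM_comp FP hj h1 h3).
by apply: pullM_eq => x /=; rewrite jK.
Qed.

Lemma state_tensorP (X Y : topologicalType)
    (M : closed_mfd R n X) (N : closed_mfd R n Y)
    (z : fieldM F M -> mor C -> S) (z' : fieldM F N -> mor C -> S) :
  state_module z -> state_module z' -> state_module (state_tensor z z').
Proof.
move=> zM z'N phi h iphi f; rewrite /state_tensor.
have el := dinl_embedding M N; have er := dinr_embedding M N.
have rlC : ~` range (@dinl _ _ M N) = range (@dinr _ _ M N).
  apply/seteqP; split=> [u nu|_ [y _ <-] [x _]]; last exact: dinl_dinr.
  by have [[x ux]|[y ->]] := dset_cover u; [case: nu; exists x|exists y].
have cl : closed (range (@dinl _ _ M N)).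
  rewrite -[range _]setCK rlC; apply: open_closedC.
  by have [_ _] := er; apply; exact: openT.
have cr : closed (range (@dinr _ _ M N)).
  rewrite -rlC; apply: open_closedC.
  by have [_ _] := el; apply; exact: openT.
have [phil [hl il El]] := isotopy_restrict el cl h iphi.
have [phir [hr ir Er]] := isotopy_restrict er cr h iphi.
congr qtimes.
- rewrite -[RHS](zM _ hl il); congr z.
  apply: (@pull_res_homeo X _ M (mfd_dunion M (closed_mfd0 R n Y))
    (mfd_dunion M N) (@dsetSl X Y M N) _ (dinl_homeo M) phi h phil hl f) => x.
  have /(congr1 set_val) := El x; move=> e; apply: set_val_inj.
  rewrite [LHS]e; congr (set_val (phi _)); exact: set_val_inj.
- rewrite -[RHS](z'N _ hr ir); congr z'.
  apply: (@pull_res_homeo Y _ N (mfd_dunion (closed_mfd0 R n X) N)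
    (mfd_dunion M N) (@dsetSr X Y M N) _ (dinr_homeo N) phi h phir hr f) => x.
  have /(congr1 set_val) := Er x; move=> e; apply: set_val_inj.
  rewrite [LHS]e; congr (set_val (phi _)); exact: set_val_inj.
Qed.

(* Transport along the equality \partial W \sqcup \partial W' =
   \partial (W \sqcup W'). *)
Definition boundary_dunion_field (X Y : topologicalType)
    (W : bordism R n X) (W' : bordism R n Y)
    (f : fieldM F (mfd_dunion (bord_boundary W) (bord_boundary W'))) :
    fieldM F (bord_boundary (bord_dunion W W')) :=
  eq_rect _ (fun K => fieldM F K) f _ (bord_boundary_dunion W W').

End state_modules.

(* Main.v *)
Require Import Defs.
From mathcomp Require Import all_boot all_order all_algebra.
From mathcomp Require Import all_classical all_reals topology normedtype.

Import GRing.Theory.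

(** A field on [W \sqcup W'] is the same thing as a pair of fields, one on each
    summand (FDISJ for bordisms).  Restriction to a summand commutes with
    restriction to the boundary, and a field on the boundary is determined by
    its restrictions to the two boundary summands (FDISJ for closed manifolds),
    so that this bijection restricts to a bijection between the fields on
    [W \sqcup W'] with boundary value [f] and the pairs of fields with boundary
    values [resMl f] and [resMr f]; this is [fields_over_dunion_bij].

    By (TDISJ) the summand indexed by a pair is the characteristic function of
    a tensor product of morphisms, which is the product in the monoidal semiring
    of the characteristic functions of the factors ([qtimes_qchar]).  The
    product of the two state sums unfolds to the same double sum because the
    product of the monoidal semiring distributes over infinite sums
    ([qtimes_csum]).  The latter is an exchange of summations in [S], which,
    like reindexing and discarding zero summands, comes from the partition
    axiom of a complete monoid. *)

(** * Summation in complete monoids and semirings *)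

Section complete_monoid.
Local Open Scope ring_scope.
Context {M : completeMonoidType}.

Lemma eq_csum (I : Type) (m m' : I -> M) : m =1 m' -> csum m = csum m'.
Proof. by move=> /funext ->. Qed.

(** The fibres of a bijection partition its source into singletons. *)
Lemma csum_reindex (I J : Type) (h : I -> J) (m : J -> M) : bijective h ->
  csum m = csum (fun i => m (h i)).
Proof.
move=> [g hK gK].
rewrite -(@csum_partition M I J (fun j i => h i = j)); last first.
  by move=> i; exists (h i); split.
apply: eq_csum => j.
rewrite (@csum_single M _ _ (exist _ (g j) (gK j))) /= ?gK //.
by move=> [i hi]; apply: eq_exist => /=; rewrite -hi hK.
Qed.

(** The fibres of the first projection partition the product. *)
Lemma csum_prod (I J : Type) (m : I -> J -> M) :
  csum (fun i => csum (m i)) = csum (fun p : I * J => m p.1 p.2).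
Proof.
rewrite -(@csum_partition M (I * J) I (fun i p => p.1 = i)); last first.
  by move=> p; exists p.1; split.
apply: eq_csum => i.
pose h (j : J) : {p : I * J | p.1 = i} := exist _ (i, j) erefl.
rewrite (@csum_reindex _ _ h) //.
exists (fun p => (sval p).2) => // -[[i' j] /= e].
by apply: eq_exist; rewrite e.
Qed.

Lemma exchange_csum (I J : Type) (m : I -> J -> M) :
  csum (fun i => csum (m i)) = csum (fun j => csum (m^~ j)).
Proof.
rewrite !csum_prod (@csum_reindex _ _ (fun p : J * I => (p.2, p.1))) //.
by exists (fun p => (p.2, p.1)) => -[].
Qed.

End complete_monoid.

Section complete_semiring.
Local Open Scope ring_scope.
Context {S : completeSemiRingType}.

(** In a complete semiring this follows from distributivity, the zero family
    being a multiple of itself by [0]. *)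
Lemma csum0 (I : Type) : csum (fun _ : I => 0 : S) = 0.
Proof.
rewrite -[RHS](mul0r (csum (fun _ : I => 0 : S))) -csumMl.
by apply: eq_csum => i; rewrite mul0r.
Qed.

Lemma csum_support1 (I : Type) (m : I -> S) (i0 : I) :
  (forall i, i <> i0 -> m i = 0) -> csum m = m i0.
Proof.
move=> m0.
(* Partition the index type into the class of i0 and its complement. *)
rewrite -(@csum_partition S I bool (fun b i => `[< i = i0 >] = b)); last first.
  by move=> i; exists `[< i = i0 >]; split.
rewrite (@csum_pair S _ _ true false) //; last by case; [left|right].
rewrite (@csum_single S _ _ (exist _ i0 (asboolT erefl))) /=; last first.
  by move=> [i hi]; apply: eq_exist; apply/asboolP.
rewrite [X in _ + X](_ : _ = 0) ?addr0 //.
rewrite -[RHS](csum0 {i | `[< i = i0 >] = false}).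
by apply: eq_csum => -[i hi] /=; apply: m0; apply/asboolPn/negbT.
Qed.

Lemma csum_mul (I J : Type) (a : I -> S) (b : J -> S) :
  csum b * csum a = csum (fun p : I * J => b p.2 * a p.1).
Proof.
rewrite -csumMl -(csum_prod _ _ (fun i j => b j * a i)).
by apply: eq_csum => i; rewrite csumMr.
Qed.

End complete_semiring.

(** * The product of the monoidal semiring *)

Section monoidal_semiring.
Local Open Scope ring_scope.
Context {S : completeSemiRingType} {C : strict_monoidal}.

Lemma qtimes_csum (I J : Type) (a : I -> mor C -> S) (b : J -> mor C -> S) :
  qtimes (csum a) (csum b) =
  csum (fun p : I * J => qtimes (a p.1) (b p.2)).
Proof.
apply/funext => gamma; rewrite /qtimes.
transitivity (csum (fun q : {q : mor C * mor C | ten q.1 q.2 = gamma} =>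
    csum (fun p : I * J => b p.2 (sval q).2 * a p.1 (sval q).1))).
  by apply: eq_csum => q; exact: csum_mul.
exact: exchange_csum.
Qed.

(** Among the pairs [(alpha, beta)] with a given tensor product, only
    [(g, h)] can contribute to the sum that defines the product. *)
Lemma qtimes_qchar (g h : mor C) :
  qtimes (qchar S g) (qchar S h) = qchar S (ten g h).
Proof.
apply/funext => gamma; rewrite /qtimes [RHS]/qchar.
have off (q : mor C * mor C) : q <> (g, h) ->
    qchar S h q.2 * qchar S g q.1 = 0.
  case: q => alpha beta ne; rewrite /qchar /=.
  case: asboolP => [hb|_]; last by rewrite mul0r.
  case: asboolP => [ga|_]; last by rewrite mulr0.
  by case: ne; rewrite hb ga.
case: asboolP => [e|ne].
  rewrite (@csum_support1 _ _ _ (exist _ (g, h) (esym e))) /=.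
    by rewrite /qchar !asboolT // mulr1.
  by move=> [q hq] ne /=; apply: off => qE; apply: ne; exact: eq_exist.
rewrite -[RHS](csum0 {q : mor C * mor C | ten q.1 q.2 = gamma}).
apply: eq_csum => -[q hq] /=; apply: off => qE.
by apply: ne; rewrite -hq qE.
Qed.

End monoidal_semiring.

(** * Fields on a disjoint union with prescribed boundary values *)

Section fields_dunion.
Local Open Scope classical_set_scope.
Context {R : realType} {n : nat} {F : fields R n} {X Y : topologicalType}.
Context (W : bordism R n X) (W' : bordism R n Y).

Let FP := fieldsP F.

Lemma dunion_boundary_sub :
  mfd_dunion (bord_boundary W) (bord_boundary W') `<=` bord_dunion W W'.
Proof. by move=> [x|y]; exact: bord_boundary_sub. Qed.

(** The transport of [f] disappears because restriction to a submanifold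
    depends only on the submanifold. *)
Lemma resBM_boundary_dunion (G : fieldB F (bord_dunion W W'))
    (f : fieldM F (mfd_dunion (bord_boundary W) (bord_boundary W'))) :
  resBM (@bord_boundary_sub _ _ _ (bord_dunion W W')) G =
    boundary_dunion_field f <->
  resBM dunion_boundary_sub G = f.
Proof.
rewrite /boundary_dunion_field; move: (@bord_boundary_sub _ _ _ _).
case: _ / (bord_boundary_dunion W W') => s /=.
by rewrite (Prop_irrelevance s dunion_boundary_sub).
Qed.

(** Both sides are the restriction of [G] to the copy of [\partial W] in
    [W \sqcup W'], transported to [\partial W] itself. *)
Lemma resMl_boundary (G : fieldB F (bord_dunion W W')) :
  resMl (resBM dunion_boundary_sub G) =
  resBM (@bord_boundary_sub _ _ _ W) (resBl G).
Proof.
have sN : mfd_dunion (bord_boundary W) (closed_mfd0 R n Y) `<=`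
    bord_dunion W (bordism0 R n Y).
  by move=> [x|y] //; exact: bord_boundary_sub.
have s1 : mfd_dunion (bord_boundary W) (closed_mfd0 R n Y) `<=`
    bord_dunion W W'.
  by move=> [x|y] //; exact: bord_boundary_sub.
rewrite /resMl (res_BMM FP _ _ s1) /resBl.
rewrite (pull_resBM FP _ sN _ (dinl_homeo (bord_boundary W))).
  by rewrite (res_BBM FP _ _ s1).
by move=> x0 x; exact: congr1.
Qed.

Lemma resMr_boundary (G : fieldB F (bord_dunion W W')) :
  resMr (resBM dunion_boundary_sub G) =
  resBM (@bord_boundary_sub _ _ _ W') (resBr G).
Proof.
have sN : mfd_dunion (closed_mfd0 R n X) (bord_boundary W') `<=`
    bord_dunion (bordism0 R n X) W'.
  by move=> [x|y] //; exact: bord_boundary_sub.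
have s1 : mfd_dunion (closed_mfd0 R n X) (bord_boundary W') `<=`
    bord_dunion W W'.
  by move=> [x|y] //; exact: bord_boundary_sub.
rewrite /resMr (res_BMM FP _ _ s1) /resBr.
rewrite (pull_resBM FP _ sN _ (dinr_homeo (bord_boundary W'))).
  by rewrite (res_BBM FP _ _ s1).
by move=> x0 x; exact: congr1.
Qed.

Context (f : fieldM F (mfd_dunion (bord_boundary W) (bord_boundary W'))).

Lemma fields_over_dunionP (G : fieldB F (bord_dunion W W')) :
  resBM (@bord_boundary_sub _ _ _ (bord_dunion W W')) G =
    boundary_dunion_field f <->
  resBM (@bord_boundary_sub _ _ _ W) (resBl G) = resMl f /\
  resBM (@bord_boundary_sub _ _ _ W') (resBr G) = resMr f.
Proof.
rewrite resBM_boundary_dunion -resMl_boundary -resMr_boundary.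
split=> [->//|[El Er]].
by apply: (bij_inj (fdisjM FP _ _)); rewrite /= El Er.
Qed.

Definition fields_over_split (G : fields_over (boundary_dunion_field f)) :
    fields_over (resMl f) * fields_over (resMr f) :=
  let GP := (fields_over_dunionP (sval G)).1 (svalP G) in
  (exist _ (resBl (sval G)) GP.1, exist _ (resBr (sval G)) GP.2).

Lemma fields_over_dunion_bij : bijective fields_over_split.
Proof.
have [join splitK joinK] := fdisjB FP W W'.
have joinE G G' : resBl (join (G, G')) = G /\ resBr (join (G, G')) = G'.
  by have [-> ->] := joinK (G, G').
have joinP (p : fields_over (resMl f) * fields_over (resMr f)) :
    resBM (@bord_boundary_sub _ _ _ (bord_dunion W W'))
      (join (sval p.1, sval p.2)) = boundary_dunion_field f.
  case: p => [[G hG] [G' hG']] /=.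
  by apply/fields_over_dunionP; have [-> ->] := joinE G G'.
exists (fun p => exist _ _ (joinP p) : fields_over (boundary_dunion_field f)).
  by move=> [G hG]; apply/eq_exist/splitK.
move=> [[G hG] [G' hG']]; have [El Er] := joinE G G'.
by congr pair; apply/eq_exist.
Qed.

End fields_dunion.

Theorem theorem6p8 (R : realType) (n : nat)
    (S : completeSemiRingType) (C : strict_monoidal)
    (F : fields R n) (T : actions F C)
    (X Y : topologicalType) (W : bordism R n X) (W' : bordism R n Y)
    (f : fieldM F (mfd_dunion (bord_boundary W) (bord_boundary W'))) :
  state_sum S T (bord_dunion W W') (boundary_dunion_field f) =
  state_tensor (state_sum S T W) (state_sum S T W') f.
Proof.
rewrite /state_tensor /state_sum qtimes_csum.
rewrite (csum_reindex _ _ _ _ (fields_over_dunion_bij _ _ f)).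
apply: eq_csum => G /=.
by rewrite qtimes_qchar (tdisj (actionsP T)).
Qed.
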